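(* Let $(F,\|\cdot\|)$ be a finite, positively polarizable hyperbolically normed proper cone (over $\mathbb{R}$) such that there exists $t_*\in F$ with $\|t_*\|=1$ and $\|\cdot\|$ is strictly hyperbolic. Suppose, in addition, that $(F,\|\cdot\|)$ satisfies one of the following conditions: (i) $F$ is a future cone in $\mathrm{span}(F)$, i.e., $F=C_t^+(\mathrm{span}(F))$ for some $t\in\mathrm{span}(F)$ with $\langle t,t\rangle>0$; (ii) there exists $t\in\mathrm{core}(F)$ with $\|t\|=1$; (iii) there exists a topology on $\mathrm{span}(F)$ with which it is a topological vector space and $\langle v,v\rangle=0$ for all $v\in\partial F$. Then the induced inner product $\langle\cdot,\cdot\rangle$ on $\mathrm{span}(F)$ is Lorentzian.
   Context: A linear cone over $\mathbb{R}$ is a commutative, cancellative monoid $(F,+)$ with a scalar multiplication $[0,\infty)\times F\to F$ such that $\lambda(v+w)=\lambda v+\lambda w$, $(\lambda+\mu)v=\lambda v+\mu v$, $\lambda(\mu v)=(\lambda\mu)v$, $1v=v$. It is proper if no $v\in F\setminus\{0\}$ has an additive inverse in $F$. $\mathrm{span}(F)=(F\times F)/\sim$, with $(v_1,w_1)\sim(v_2,w_2)$ iff $v_1+w_2=v_2+w_1$, is a real vector space into which $F$ embeds via $v\mapsto[(v,0)]$; $F$ is identified with its image, and every element of $\mathrm{span}(F)$ has the form $v-w$ with $v,w\in F$. A hyperbolic norm on $F$ is a map $\|\cdot\|:F\to[0,\infty]$ with $\|v+w\|\ge\|v\|+\|w\|$ and $\|\lambda v\|=\lambda\|v\|$ for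 all $v,w\in F$, $\lambda\ge0$ (convention $0\cdot\infty=0$); $(F,\|\cdot\|)$ is then a hyperbolically normed cone. It is finite if $\|v\|<\infty$ for all $v\in F$; positively polarizable if $\|v+2w\|^2+\|v\|^2=2\|v+w\|^2+2\|w\|^2$ for all $v,w\in F$; strictly hyperbolic if $\|u+v\|=\|u\|+\|v\|$ with $u,v\in F$ implies $u=\lambda v$ or $v=\lambda u$ for some $\lambda\ge0$. An inner product is a symmetric bilinear form. For a finite positively polarizable hyperbolic norm, $\langle v,w\rangle:=\frac12(\|v+w\|^2-\|v\|^2-\|w\|^2)$, $v,w\in F$, is symmetric and nonnegatively bilinear on $F$ and extends uniquely to a symmetric bilinear form on $\mathrm{span}(F)$, the induced inner product. An inner product on a real vector space $V$ is Lorentzian if $V=V_1\oplus V_2$ with $\dim V_1=1$, such that it is positive definite on $V_1$ and negative definite on $V_2$ ($V$ need not be finite-dimensional). For an inner product on $V$: $C(V)=\{v\in V:\langle v,v\rangle\ge0\}$ and, for $t\in V$, $C_t^+(V)=\{v\in C(V):\langle v,t\rangle\ge0\}$. $\mathrm{core}(F)=\{x\in F:\forall v\in\mathrm{span}(F)\ \exists\,\epsilon_v>0: x+\epsilon_v v\in F\}$. $\partial F$ is the topological boundary of $F$ in $\mathrm{span}(F)$. Topological vector spaces are over $\mathbb{R}$ with its usual topology and are not assumed Hausdorff. *)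

(* Defs.v *)
Set Warnings "-notation-overridden,-ambiguous-paths,-redundant-canonical-projection".
From HB Require Import structures.
From mathcomp Require Import all_boot all_order all_algebra.
From mathcomp Require Import generic_quotient interval_inference ring lra.
From mathcomp Require Import boolp classical_sets reals ereal topology normedtype.

Set Implicit Arguments.
Unset Strict Implicit.
Unset Printing Implicit Defensive.

Import Order.TTheory GRing.Theory Num.Theory.
Import numFieldTopology.Exports.
Local Open Scope classical_set_scope.
Local Open Scope ring_scope.
Local Open Scope quotient_scope.

HB.mixin Record Nmodule_isLinearCone (R : realType) F of GRing.Nmodule F := {
  cscale : {nonneg R} -> F -> F;
  coneI : forall u : F, injective (+%R u);
  cscaleDr : forall l (v w : F), cscale l (v + w) = cscale l v + cscale l w;
  cscaleDl : forall (l m : {nonneg R}) (v : F),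
    cscale (l%:num + m%:num)%:nng v = cscale l v + cscale m v;
  cscaleA : forall (l m : {nonneg R}) (v : F),
    cscale l (cscale m v) = cscale (l%:num * m%:num)%:nng v;
  cscale1 : forall v : F, cscale 1%:nng v = v
}.

#[short(type="linearConeType")]
HB.structure Definition LinearCone (R : realType) :=
  {F of GRing.Nmodule F & Nmodule_isLinearCone R F}.

Arguments cscale {R s} l v.

Section ConeTheory.
Variables (R : realType) (F : linearConeType R).
Implicit Types (v w : F) (l m n k : {nonneg R}).

Lemma cscaleD2 l m n k v : l%:num + m%:num = n%:num + k%:num ->
  cscale l v + cscale m v = cscale n v + cscale k v.
Proof. by move=> e; rewrite -!cscaleDl; congr cscale; apply: val_inj. Qed.

Lemma cscaler0 l : cscale l (0 : F) = 0.
Proof. by apply: (@coneI _ _ (cscale l 0)); rewrite -cscaleDr !addr0. Qed.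

Lemma cscale0 v : cscale 0%:nng v = 0.
Proof.
apply: (@coneI _ _ (cscale 0%:nng v)); rewrite addr0 -cscaleDl.
by congr cscale; apply: val_inj; rewrite /= addr0.
Qed.

End ConeTheory.

Section Span.
Variables (R : realType) (F : linearConeType R).
Implicit Types (x y : F * F) (a b : R).

Definition span_eqv x y : bool := x.1 + y.2 == y.1 + x.2.

Lemma span_eqv_refl : reflexive span_eqv.
Proof. by move=> x; rewrite /span_eqv. Qed.

Lemma span_eqv_sym : symmetric span_eqv.
Proof. by move=> x y; rewrite /span_eqv eq_sym. Qed.

Lemma span_eqv_trans : transitive span_eqv.
Proof.
move=> y x z /eqP xy /eqP yz; apply/eqP; apply: (@coneI _ _ (y.1 + y.2)).
rewrite [y.1 + y.2]addrC addrACA [y.2 + x.1]addrC xy yz.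
by rewrite [z.1 + y.2]addrC [LHS]addrACA [x.2 + z.1]addrC [y.2 + y.1]addrC.
Qed.

Canonical span_equiv :=
  EquivRel span_eqv span_eqv_refl span_eqv_sym span_eqv_trans.

Definition cone_span : Type := {eq_quot span_equiv}.
HB.instance Definition _ := Choice.on cone_span.
HB.instance Definition _ := EqQuotient.on cone_span.

Definition span_zero : cone_span := \pi_cone_span (0, 0).
Definition span_add : cone_span -> cone_span -> cone_span :=
  lift_op2 cone_span (fun x y => (x.1 + y.1, x.2 + y.2)).
Definition span_opp : cone_span -> cone_span :=
  lift_op1 cone_span (fun x => (x.2, x.1)).

Lemma repr_span x :
  (repr (\pi_cone_span x)).1 + x.2 = x.1 + (repr (\pi_cone_span x)).2.
Proof.
have /eqmodP/eqP : repr (\pi_cone_span x) = x %[mod cone_span] by rewrite reprK.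
by [].
Qed.

Lemma pi_span_add :
  {morph \pi_cone_span : x y / (x.1 + y.1, x.2 + y.2) >-> span_add x y}.
Proof.
unlock span_add => x y; apply/eqmodP/eqP => /=.
have := repr_span x; move: (repr (\pi_cone_span x)) => x' hx.
have := repr_span y; move: (repr (\pi_cone_span y)) => y' hy.
by rewrite addrACA -hx -hy addrACA.
Qed.
Canonical pi_span_add_morph := PiMorph2 pi_span_add.

Lemma pi_span_opp : {morph \pi_cone_span : x / (x.2, x.1) >-> span_opp x}.
Proof.
unlock span_opp => x; apply/eqmodP/eqP => /=.
have := repr_span x; move: (repr (\pi_cone_span x)) => x' hx.
by rewrite addrC hx addrC.
Qed.
Canonical pi_span_opp_morph := PiMorph1 pi_span_opp.

Lemma span_addA : associative span_add.
Proof.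
move=> x y z; rewrite -[x]reprK -[y]reprK -[z]reprK !piE /=.
by rewrite !addrA.
Qed.

Lemma span_addC : commutative span_add.
Proof.
by move=> x y; rewrite -[x]reprK -[y]reprK !piE/= addrC [X in (_, X)]addrC.
Qed.

Lemma span_add0 : left_id span_zero span_add.
Proof.
by move=> x; rewrite -[x]reprK /span_zero !piE /= !add0r -surjective_pairing.
Qed.

Lemma span_addN : left_inverse span_zero span_opp span_add.
Proof.
move=> x; rewrite -[x]reprK /span_zero !piE /=.
by apply/eqmodP/eqP => /=; rewrite addr0 add0r addrC.
Qed.

HB.instance Definition _ :=
  GRing.isZmodule.Build cone_span span_addA span_addC span_add0 span_addN.

Lemma pi_spanD :
  {morph \pi_cone_span : x y / (x.1 + y.1, x.2 + y.2) >-> (x : cone_span) + y}.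
Proof. exact: pi_span_add. Qed.
Canonical pi_spanD_morph := PiMorph2 pi_spanD.

Lemma pospart_subproof a : 0 <= Num.max a 0.
Proof. by rewrite le_max lexx orbT. Qed.

Definition pospart a : {nonneg R} := NngNum (pospart_subproof a).

(* The multiple of [(v, w)] by p - q, for p, q >= 0. *)
Definition pair_scale2 (p q : {nonneg R}) x : F * F :=
  (cscale p x.1 + cscale q x.2, cscale p x.2 + cscale q x.1).

Definition pair_scale a x : F * F :=
  pair_scale2 (pospart a) (pospart (- a)) x.

Definition span_scale a : cone_span -> cone_span :=
  lift_op1 cone_span (pair_scale a).

Lemma pi_span_scale a :
  {morph \pi_cone_span : x / pair_scale a x >-> span_scale a x}.
Proof.
unlock span_scale => x; apply/eqmodP/eqP => /=.
have := repr_span x; move: (repr (\pi_cone_span x)) => x' hx.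
rewrite addrACA -!cscaleDr [RHS]addrACA -!cscaleDr -hx.
by rewrite [x.2 + _]addrC hx [x'.2 + _]addrC.
Qed.
Canonical pi_span_scale_morph a := PiMorph1 (pi_span_scale a).

Lemma pospart_sub a : (pospart a)%:num - (pospart (- a))%:num = a.
Proof. by rewrite /=; case: (lerP a 0); case: (lerP (- a) 0) => *; lra. Qed.

Lemma pair_scale2_eqv p q p' q' x : p%:num - q%:num = p'%:num - q'%:num ->
  \pi_cone_span (pair_scale2 p q x) = \pi_cone_span (pair_scale2 p' q' x).
Proof.
move=> e; apply/eqmodP/eqP => /=.
have e1 : p%:num + q'%:num = p'%:num + q%:num by lra.
have e2 : q%:num + p'%:num = q'%:num + p%:num by lra.
rewrite [cscale p' x.2 + _]addrC [cscale p x.2 + _]addrC.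
by rewrite addrACA (cscaleD2 _ e1) (cscaleD2 _ e2) [RHS]addrACA.
Qed.

Lemma span_scaleA a b (x : cone_span) :
  span_scale a (span_scale b x) = span_scale (a * b) x.
Proof.
rewrite -[x]reprK !piE; case: (repr x) => v w /=.
set p := pospart a; set q := pospart (- a).
set p' := pospart b; set q' := pospart (- b).
transitivity (\pi_cone_span (pair_scale2 (p%:num * p'%:num + q%:num * q'%:num)%:nng
  (p%:num * q'%:num + q%:num * p'%:num)%:nng (v, w))).
  congr \pi; rewrite /pair_scale /pair_scale2 /= !cscaleDr !cscaleA !cscaleDl.
  by congr pair; rewrite [X in _ + X = _]addrC addrACA;
    congr (_ + _ + (_ + _)); congr cscale; apply: val_inj.
rewrite /pair_scale; apply: pair_scale2_eqv; rewrite pospart_sub /=.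
by rewrite -[a in RHS]pospart_sub -[b in RHS]pospart_sub /=; ring.
Qed.

Lemma span_scale1 : left_id 1 span_scale.
Proof.
move=> x; rewrite -[x]reprK !piE.
transitivity (\pi_cone_span (pair_scale2 1%:nng 0%:nng (repr x))).
  by apply: pair_scale2_eqv; rewrite pospart_sub /= subr0.
by rewrite /pair_scale2 !cscale1 !cscale0 !addr0 -surjective_pairing.
Qed.

Lemma span_scaleDr : right_distributive span_scale +%R.
Proof.
move=> a x y; rewrite -[x]reprK -[y]reprK !piE; congr \pi.
rewrite /pair_scale /pair_scale2 /= !cscaleDr.
by congr pair; rewrite addrACA.
Qed.

Lemma span_scaleDl (x : cone_span) : {morph span_scale^~ x : a b / a + b}.
Proof.
move=> a b /=.
set p := pospart a; set q := pospart (- a).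
set p' := pospart b; set q' := pospart (- b).
rewrite -[x]reprK !piE.
transitivity (\pi_cone_span (pair_scale2 (p%:num + p'%:num)%:nng
  (q%:num + q'%:num)%:nng (repr x))).
  apply: pair_scale2_eqv; rewrite pospart_sub.
  by rewrite -[a in LHS]pospart_sub -[b in LHS]pospart_sub /=; ring.
congr \pi; rewrite /pair_scale /pair_scale2 /= !cscaleDl.
by congr pair; rewrite addrACA.
Qed.

HB.instance Definition _ := GRing.Zmodule_isLmodule.Build R cone_span
  span_scaleA span_scale1 span_scaleDr span_scaleDl.

Definition embed (v : F) : cone_span := \pi_cone_span (v, 0).

Lemma embedD : {morph embed : v w / v + w}.
Proof. by move=> v w; rewrite /embed !piE /= addr0. Qed.

Lemma embedZ (l : {nonneg R}) v : embed (cscale l v) = l%:num *: embed v.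
Proof.
rewrite /embed [RHS](esym (pi_span_scale _ _)).
transitivity (\pi_cone_span (pair_scale2 l 0%:nng (v, 0))).
  by rewrite /pair_scale2 /= !cscaler0 cscale0 !addr0.
by apply: pair_scale2_eqv; rewrite pospart_sub /= subr0.
Qed.

Lemma embed_inj : injective embed.
Proof. by move=> v w /eqmodP/eqP /=; rewrite !addr0. Qed.

Lemma span_sub (x : cone_span) : x = embed (repr x).1 - embed (repr x).2.
Proof.
apply: (addIr (embed (repr x).2)); rewrite subrK -{1}[x]reprK /embed !piE /=.
by apply/eqmodP/eqP => /=; rewrite !addr0.
Qed.

End Span.

Section HyperbolicNorm.
Variables (R : realType) (F : linearConeType R).

Definition proper_cone : Prop := forall v w : F, v + w = 0 -> v = 0.

Local Open Scope ereal_scope.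

(* The convention 0 * +oo = 0 is the one of \bar R. *)
Record hyperbolic_norm (nrm : F -> \bar R) : Prop := HyperbolicNorm {
  hnorm_ge0 : forall v, 0 <= nrm v;
  hnormD : forall v w : F, nrm v + nrm w <= nrm (v + w)%R;
  hnormZ : forall (l : {nonneg R}) v, nrm (cscale l v) = l%:num%:E * nrm v
}.

Definition finite_norm (nrm : F -> \bar R) : Prop := forall v, nrm v < +oo.

Definition positively_polarizable (nrm : F -> \bar R) : Prop :=
  forall v w : F,
    nrm (v + cscale 2%:nng w)%R ^+ 2 + nrm v ^+ 2
    = 2%:E * nrm (v + w)%R ^+ 2 + 2%:E * nrm w ^+ 2.

Definition strictly_hyperbolic (nrm : F -> \bar R) : Prop :=
  forall u v : F, nrm (u + v)%R = nrm u + nrm v ->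
    exists l : {nonneg R}, u = cscale l v \/ v = cscale l u.

End HyperbolicNorm.

Section InnerProduct.
Variables (R : realType) (V : lmodType R).
Implicit Types (g : V -> V -> R).

Record inner_product g : Prop := InnerProduct {
  ip_sym : forall v w, g v w = g w v;
  ip_scalar : forall v, scalar (g v)
}.

(* dim V1 = 1 is expressed by V1 = R e with e != 0, and V = V1 (+) V2 by
   V1 + V2 = V and V1 `&` V2 = 0. *)
Definition lorentzian g : Prop :=
  inner_product g /\
  exists V1 V2 : set V,
    [/\ submod_closed (mem V1) /\ submod_closed (mem V2),
        (forall v, exists v1 v2, [/\ V1 v1, V2 v2 & v = v1 + v2])
          /\ V1 `&` V2 = [set 0],
        exists2 e, e != 0 & V1 = [set a *: e | a in [set: R]],
        forall v, V1 v -> v != 0 -> 0 < g v v &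
        forall v, V2 v -> v != 0 -> g v v < 0].

Definition causal_cone g : set V := [set v | 0 <= g v v].

Definition future_cone g (t : V) : set V :=
  [set v | causal_cone g v /\ 0 <= g v t].

(* Only the topology and the module structure are bundled here: their
   compatibility is [vector_topology]. *)
Definition with_topology (T : isOpenTopological V) :
  preTopologicalLmodType R := HB.pack_for (preTopologicalLmodType R) V T.

End InnerProduct.

Definition vector_topology (R : realType) (W : preTopologicalLmodType R) : Prop
  := continuous (fun x : W * W => x.1 + x.2)
     /\ continuous (fun z : R^o * W => z.1 *: z.2).

Definition boundary (T : topologicalType) (A : set T) : set T :=
  closure A `\` A°.

Section InducedInnerProduct.
Variables (R : realType) (F : linearConeType R) (nrm : F -> \bar R).

Definition polar (v w : F) : R :=
  (fine (nrm (v + w)) ^+ 2 - fine (nrm v) ^+ 2 - fine (nrm w) ^+ 2) / 2.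

(* <v1 - w1, v2 - w2> expanded by bilinearity; [induced_ipE] and
   [induced_ip_inner_product] below show that this is independent of the
   representatives and bilinear, when nrm is a finite positively polarizable
   hyperbolic norm. *)
Definition pair_ip (x y : F * F) : R :=
  polar x.1 y.1 - polar x.1 y.2 - polar x.2 y.1 + polar x.2 y.2.

Definition induced_ip (x y : cone_span F) : R := pair_ip (repr x) (repr y).

Lemma polarC v w : polar v w = polar w v.
Proof. by rewrite /polar [v + w]addrC; congr (_ / _); rewrite addrAC. Qed.

Hypothesis nrmH : hyperbolic_norm nrm.
Hypothesis nrm_fin : finite_norm nrm.
Hypothesis nrm_pol : positively_polarizable nrm.

Let q (v : F) : R := fine (nrm v) ^+ 2.

Let nrmE v : nrm v = (fine (nrm v))%:E.
Proof. by rewrite fineK// ge0_fin_numE ?nrm_fin// (hnorm_ge0 nrmH). Qed.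

Let qE v w : q (v + w + w) + q v = 2 * q (v + w) + 2 * q w.
Proof.
have := nrm_pol v w.
have -> : cscale 2%:nng w = w + w.
  rewrite -{2 3}[w]cscale1 -cscaleDl; congr cscale; apply: val_inj => /=.
  by [].
rewrite addrA nrmE (nrmE v) (nrmE (v + w)) (nrmE w) -!EFin_expe -!EFinM.
by rewrite -!EFinD => -[].
Qed.

Let polarDl u v w : polar (u + v) w = polar u w + polar v w.
Proof.
have e1 := qE u (v + w); have e2 := qE (u + v + v) w.
have e3 := qE u v; have e4 := qE (u + w) v.
have a1 : u + (v + w) + (v + w) = u + v + v + w + w.
  by rewrite !addrA (addrAC (u + v)).
have a2 : u + v + v + w = u + w + v + v.
  by rewrite (addrAC (u + v)) (addrAC u).
have a3 : u + w + v = u + v + w by rewrite addrAC.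
have a4 : u + (v + w) = u + v + w by rewrite addrA.
move: e1 e2 e3 e4; rewrite a1 a2 a3 a4 /polar -!/(q _) => e1 e2 e3 e4.
lra.
Qed.

Let polar_ge0 v w : 0 <= polar v w.
Proof.
have p0 u : 0 <= fine (nrm u) by apply/fine_ge0/(hnorm_ge0 nrmH).
have h : fine (nrm v) + fine (nrm w) <= fine (nrm (v + w)).
  by rewrite -lee_fin EFinD -!nrmE (hnormD nrmH).
rewrite /polar divr_ge0//.
have := p0 v; have := p0 w; nra.
Qed.

Let polarZl (l : {nonneg R}) v w : polar (cscale l v) w = l%:num * polar v w.
Proof.
pose f x := polar (cscale (pospart x) v) w.
have fl (k : {nonneg R}) : polar (cscale k v) w = f k%:num.
  by rewrite /f; congr polar; congr cscale; apply: val_inj => /=; rewrite max_l.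
have fD x y : 0 <= x -> 0 <= y -> f (x + y) = f x + f y.
  move=> x0 y0; rewrite /f -polarDl -cscaleDl; congr polar; congr cscale.
  by apply: val_inj; rewrite /= !max_l// addr_ge0.
have f_ge0 x : 0 <= f x by exact: polar_ge0.
have f_mono x y : 0 <= x -> x <= y -> f x <= f y.
  by move=> x0 xy; rewrite -(subrK x y) fD ?subr_ge0// lerDr.
have f0 : f 0 = 0 by apply: (addIr (f 0)); rewrite -fD// !add0r.
have fM n x : 0 <= x -> f (n%:R * x) = n%:R * f x.
  move=> x0; elim: n => [|n IH]; first by rewrite !mul0r.
  by rewrite -natr1 !mulrDl !mul1r fD ?mulr_ge0// IH.
have f1 : f 1 = polar v w by rewrite -(fl 1%:nng) cscale1.
have fn n : f n%:R = n%:R * f 1 by rewrite -fM// mulr1.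
rewrite fl -f1; have : 0 <= l%:num by []; move: (l%:num) => x x0 {fl}.
clearbody f.
have bound n : n%:R * `|f x - x * f 1| <= f 1.
  have nx0 : 0 <= n%:R * x by rewrite mulr_ge0.
  have /andP[k1 k2] := truncn_itv nx0.
  set k := Num.truncn _ in k1 k2.
  have l1 : k%:R * f 1 <= n%:R * f x by rewrite -fn -fM// f_mono.
  have l2 : n%:R * f x <= k.+1%:R * f 1 by rewrite -fn -fM// f_mono// ltW.
  have l3 : k%:R * f 1 <= n%:R * x * f 1 by rewrite ler_wpM2r.
  have l4 : n%:R * x * f 1 <= k.+1%:R * f 1 by rewrite ler_wpM2r// ltW.
  rewrite -[n%:R in leLHS]normr_nat -normrM ler_norml.
  rewrite -natr1 in l2 l4; rewrite mulrBr mulrA; apply/andP; split; lra.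
apply/eqP; rewrite -subr_eq0 -normr_eq0; apply/negPn/negP => d0.
have dgt0 : 0 < `|f x - x * f 1| by rewrite lt_def d0 normr_ge0.
have := bound (Num.truncn (f 1 / `|f x - x * f 1|)).+1.
by rewrite -ler_pdivlMr// leNgt truncnS_gt.
Qed.

Lemma induced_ipE (x y : F * F) :
  induced_ip (\pi_(cone_span F) x) (\pi_(cone_span F) y) = pair_ip x y.
Proof.
have polarDr u v w : polar w (u + v) = polar w u + polar w v.
  by rewrite polarC polarDl !(polarC w).
rewrite /induced_ip /pair_ip.
have := repr_span x; move: (repr (\pi_(cone_span F) x)) => x' hx.
have := repr_span y; move: (repr (\pi_(cone_span F) y)) => y' hy.
have ex z : polar x'.1 z + polar x.2 z = polar x.1 z + polar x'.2 z.
  by rewrite -!polarDl hx.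
have ey z : polar z y'.1 + polar z y.2 = polar z y.1 + polar z y'.2.
  by rewrite -!polarDr hy.
have := ex y'.1; have := ex y'.2; have := ey x.1; have := ey x.2.
lra.
Qed.

Lemma induced_ip_embed (v w : F) :
  induced_ip (embed v) (embed w) = polar v w.
Proof.
have p0 u : polar 0 u = 0 by apply: (addIr (polar 0 u)); rewrite -polarDl !add0r.
by rewrite /embed induced_ipE /pair_ip /= !(polarC _ 0) !p0 !subr0 addr0.
Qed.

Lemma induced_ip_inner_product : inner_product induced_ip.
Proof.
have ipC x y : induced_ip x y = induced_ip y x.
  by rewrite /induced_ip /pair_ip !(polarC (repr y).1) !(polarC (repr y).2); lra.
split=> // x a y z; rewrite 3!(ipC x).
rewrite -[x]reprK -[y]reprK -[z]reprK.
rewrite [a *: _](esym (pi_span_scale _ _)) -pi_spanD !induced_ipE.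
case: (repr x) => x1 x2; case: (repr y) => y1 y2; case: (repr z) => z1 z2.
rewrite /pair_ip /= !polarDl !polarZl -[a in RHS]pospart_sub.
ring.
Qed.

End InducedInnerProduct.

Definition cone_set (R : realType) (F : linearConeType R) : set (cone_span F) :=
  range (@embed R F).
Arguments cone_set {R} F.

Definition core (R : realType) (F : linearConeType R) : set F :=
  [set x | forall v : cone_span F,
    exists2 e : R, 0 < e & cone_set F (embed x + e *: v)].
Arguments core {R} F.

Definition null_on_boundary (R : realType) (F : linearConeType R)
    (g : cone_span F -> cone_span F -> R)
    (T : isOpenTopological (cone_span F)) : Prop :=
  forall v, boundary (cone_set F : set (with_topology T)) v -> g v v = 0.

(* Main.v *)
Require Import Defs.
From mathcomp Require Import all_boot all_order all_algebra.
From mathcomp Require Import interval_inference ring lra.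
From mathcomp Require Import boolp classical_sets reals ereal topology normedtype.

(** The induced inner product is Lorentzian as soon as some [t] of positive
square satisfies [g x x < 0] for every nonzero [x] orthogonal to [t]: the
splitting is then the line through [t] plus the orthogonal complement of [t]
([lorentzian_of_orthogonal]).  Such a [t] is found in each of the three cases.

If [F] is the future cone of [t], then a nonzero [x] orthogonal to [t] with
[g x x >= 0] would lie in [F] together with [- x], against properness.

If [t] is a core point of norm 1, both [u = t + d x] and [v = t - d x] lie in
[F] for some [d > 0].  Orthogonality gives them the same square
[1 + d^2 g x x], while the reverse triangle inequality bounds the sum of their
norms by the norm 2 of [u + v = 2 t]; hence [g x x <= 0].  Equality would be
the equality case of the reverse triangle inequality, so that [u] and [v] would
be proportional by strict hyperbolicity, and pairing with [t] would force
[u = v], that is [x = 0].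

If [g] vanishes on the boundary of [F] for a vector topology, then a unit
vector of [F] is not on the boundary, so it is interior to [F].  Moving along a
line is continuous, hence an interior point is a core point, and the previous
case applies. *)

Set Implicit Arguments.
Unset Strict Implicit.
Unset Printing Implicit Defensive.

Import Order.TTheory GRing.Theory Num.Theory.
Import numFieldNormedType.Exports.
Local Open Scope classical_set_scope.
Local Open Scope ring_scope.

Section InnerProductTheory.
Variables (R : realType) (V : lmodType R) (g : V -> V -> R).
Hypothesis gP : inner_product g.

Lemma ipDr x y z : g x (y + z) = g x y + g x z.
Proof. by have := ip_scalar gP x 1 y z; rewrite scale1r mul1r. Qed.

Lemma ip0r x : g x 0 = 0.
Proof. by apply: (addIr (g x 0)); rewrite -ipDr !add0r. Qed.

Lemma ipZr x a y : g x (a *: y) = a * g x y.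
Proof. by have := ip_scalar gP x a y 0; rewrite !addr0 ip0r addr0. Qed.

Lemma ipDl x y z : g (x + y) z = g x z + g y z.
Proof. by rewrite !(ip_sym gP _ z) ipDr. Qed.

Lemma ipZl a x y : g (a *: x) y = a * g x y.
Proof. by rewrite !(ip_sym gP _ y) ipZr. Qed.

Lemma ip_sqr_orthogonal t x a : g x t = 0 ->
  g (t + a *: x) (t + a *: x) = g t t + a ^+ 2 * g x x.
Proof.
by move=> xt; rewrite ipDl !ipDr !ipZl !ipZr (ip_sym gP t x) xt; ring.
Qed.

(** A vector of positive square splits off its line, the projection being
[v |-> (g v t / g t t) *: t]. *)
Lemma lorentzian_of_orthogonal t : 0 < g t t ->
  (forall x, g x t = 0 -> x != 0 -> g x x < 0) -> lorentzian g.
Proof.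
move=> t0 neg; split=> //.
exists [set a *: t | a in [set: R]], [set v | g v t = 0]; split.
- split; split.
  + by rewrite inE; exists 0; rewrite ?scale0r.
  + move=> a u v; rewrite !inE => -[b _ <-] [c _ <-].
    by exists (a * b + c); rewrite // scalerDl scalerA.
  + by rewrite inE /= (ip_sym gP) ip0r.
  + by move=> a u v; rewrite !inE /= ipDl ipZl => -> ->; rewrite mulr0 addr0.
- split=> [v|].
    exists ((g v t / g t t) *: t), (v - (g v t / g t t) *: t); split.
    + by exists (g v t / g t t).
    + by rewrite /= -scaleNr ipDl ipZl mulNr divfK ?subrr// gt_eqF.
    + by rewrite addrC subrK.
  apply/seteqP; split=> [_ [[a _ <-] /=]|_ ->].
    by rewrite ipZl => /eqP; rewrite mulf_eq0 (gt_eqF t0) orbF => /eqP->;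
      rewrite scale0r.
  by split; [exists 0; rewrite ?scale0r | rewrite /= (ip_sym gP) ip0r].
- exists t => //; apply: contraTneq t0 => ->.
  by rewrite ip0r ltxx.
- move=> _ [a _ <-]; rewrite scaler_eq0 negb_or => /andP[a0 _].
  by rewrite ipZl ipZr mulrA mulr_gt0// -expr2 exprn_even_gt0.
- exact: neg.
Qed.

End InnerProductTheory.

Section ConeSet.
Variables (R : realType) (F : linearConeType R).
Implicit Types x y : cone_span F.

Lemma embed0 : embed (0 : F) = 0.
Proof. by apply: (addIr (embed (0 : F))); rewrite -embedD !add0r. Qed.

Lemma cone_setD x y : cone_set F x -> cone_set F y -> cone_set F (x + y).
Proof. by move=> [v _ <-] [w _ <-]; exists (v + w); rewrite // embedD. Qed.

Lemma cone_setZ (a : R) x : 0 <= a -> cone_set F x -> cone_set F (a *: x).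
Proof.
by move=> a0 [v _ <-]; exists (cscale (NngNum a0) v); rewrite // embedZ.
Qed.

Lemma cone_set_segment x y (d e : R) : 0 < e -> 0 <= d <= e ->
  cone_set F x -> cone_set F (x + e *: y) -> cone_set F (x + d *: y).
Proof.
move=> e0 /andP[d0 de] Fx Fy.
have -> : x + d *: y = (1 - d / e) *: x + (d / e) *: (x + e *: y).
  rewrite scalerDr scalerA divfK ?gt_eqF// addrA -scalerDl.
  by rewrite subrK scale1r.
apply: cone_setD; apply: cone_setZ => //; last by rewrite divr_ge0// ltW.
by rewrite subr_ge0 ler_pdivrMr// mul1r.
Qed.

(** The core condition for [x] and [- x] gives two step lengths; by convexity the
smaller one serves both directions. *)
Lemma core_symmetric (t : F) x : core F t ->
  exists2 d : R, 0 < d &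
    cone_set F (embed t + d *: x) /\ cone_set F (embed t - d *: x).
Proof.
move=> tF; have [e e0 He] := tF x; have [e' e'0 He'] := tF (- x).
have Ft : cone_set F (embed t) by exists t.
exists (Num.min e e'); first by rewrite lt_min e0.
split; last rewrite -scalerN.
- by apply: cone_set_segment He => //; rewrite le_min ge_min lexx (ltW e0) ltW.
- by apply: cone_set_segment He' => //; rewrite le_min ge_min lexx orbT (ltW e0) ltW.
Qed.

Lemma proper_cone_set x : proper_cone F ->
  cone_set F x -> cone_set F (- x) -> x = 0.
Proof.
move=> Fp [v _ vx] [w _ wx]; rewrite -vx (Fp v w) ?embed0//.
by apply: (@embed_inj _ F); rewrite embedD vx wx subrr embed0.
Qed.

End ConeSet.

Section InducedInnerProduct.
Variables (R : realType) (F : linearConeType R) (nrm : F -> \bar R).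
Hypothesis nrm_hyp : hyperbolic_norm nrm.
Hypothesis nrm_fin : finite_norm nrm.
Hypothesis nrm_pol : positively_polarizable nrm.

Let g := induced_ip nrm.
Let gP : inner_product g := induced_ip_inner_product nrm_hyp nrm_fin nrm_pol.

Lemma finite_hnormE v : nrm v = (fine (nrm v))%:E.
Proof. by rewrite fineK// ge0_fin_numE ?nrm_fin// (hnorm_ge0 nrm_hyp). Qed.

Lemma induced_ip_sqr v : g (embed v) (embed v) = fine (nrm v) ^+ 2.
Proof.
rewrite /g induced_ip_embed // /polar.
have -> : v + v = cscale 2%:nng v.
  by rewrite -{1 2}[v]cscale1 -cscaleDl; congr cscale; apply: val_inj.
by rewrite (hnormZ nrm_hyp) finite_hnormE -EFinM /=; field.
Qed.

Lemma fine_hnormD v w : fine (nrm v) + fine (nrm w) <= fine (nrm (v + w)).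
Proof.
by rewrite -lee_fin EFinD -!finite_hnormE (Defs.hnormD nrm_hyp).
Qed.

(** The reverse triangle inequality on [embed t + d *: x] and
[embed t - d *: x]; its equality case rules out isotropic [x]. *)
Lemma core_orthogonal_neg t x : strictly_hyperbolic nrm ->
  core F t -> nrm t = 1%:E -> g x (embed t) = 0 -> x != 0 -> g x x < 0.
Proof.
move=> strict tF t1 xt x0.
have gtt : g (embed t) (embed t) = 1 by rewrite induced_ip_sqr t1 expr1n.
have [d d0 [[u _ uE] [v _ vE]]] := core_symmetric x tF.
have nonneg w : 0 <= fine (nrm w) by exact/fine_ge0/(hnorm_ge0 nrm_hyp).
have u2 : fine (nrm u) ^+ 2 = 1 + d ^+ 2 * g x x.
  by rewrite -induced_ip_sqr uE (ip_sqr_orthogonal gP)// gtt.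
have v2 : fine (nrm v) ^+ 2 = 1 + d ^+ 2 * g x x.
  by rewrite -induced_ip_sqr vE -scaleNr (ip_sqr_orthogonal gP)// gtt sqrrN.
have uv : fine (nrm v) = fine (nrm u).
  by apply/eqP; rewrite -(@eqrXn2 _ 2)// v2 u2.
have uvt : fine (nrm (u + v)) = 2.
  have : fine (nrm (u + v)) ^+ 2 = 2 ^+ 2.
    rewrite -induced_ip_sqr embedD uE vE addrACA subrr addr0.
    by rewrite -mulr2n -scaler_nat (ipZl gP) (ipZr gP) gtt mulr1.
  by move/eqP; rewrite eqrXn2// => /eqP.
have u1 : fine (nrm u) <= 1.
  by have := fine_hnormD u v; rewrite uv uvt; lra.
have d2 : 0 < d ^+ 2 by rewrite exprn_gt0.
have : g x x <= 0.
  by rewrite -(pmulr_rle0 _ d2); have := nonneg u; nra.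
rewrite le_eqVlt => /orP[/eqP gxx|//].
have u_eq1 : fine (nrm u) = 1.
  by apply/eqP; rewrite -(@eqrXn2 _ 2)// u2 gxx mulr0 addr0 expr1n.
have /strict[l prop] : nrm (u + v) = (nrm u + nrm v)%E.
  by rewrite finite_hnormE (finite_hnormE u) (finite_hnormE v) uvt uv u_eq1.
have gut : g (embed u) (embed t) = 1.
  by rewrite uE (ipDl gP) (ipZl gP) xt mulr0 addr0.
have gvt : g (embed v) (embed t) = 1.
  by rewrite vE -scaleNr (ipDl gP) (ipZl gP) xt mulr0 addr0.
(* pairing with t shows that the factor of proportionality is 1 *)
have uvE : embed u = embed v.
  case: prop => h.
  - have l1 : l%:num = 1.
      by move: gut; rewrite h embedZ (ipZl gP) gvt mulr1.
    by rewrite h embedZ l1 scale1r.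
  - have l1 : l%:num = 1.
      by move: gvt; rewrite h embedZ (ipZl gP) gut mulr1.
    by rewrite h embedZ l1 scale1r.
move: uvE; rewrite uE vE => /addrI/eqP; rewrite -addr_eq0 -mulr2n.
by rewrite -scaler_nat !scaler_eq0 pnatr_eq0 (gt_eqF d0) (negbTE x0).
Qed.

Lemma lorentzian_of_core t : strictly_hyperbolic nrm ->
  core F t -> nrm t = 1%:E -> lorentzian g.
Proof.
move=> strict tF t1; apply: (lorentzian_of_orthogonal gP (t := embed t)).
  by rewrite induced_ip_sqr t1 expr1n.
by move=> x; exact: core_orthogonal_neg.
Qed.

Lemma lorentzian_of_future_cone t : proper_cone F -> 0 < g t t ->
  cone_set F = future_cone g t -> lorentzian g.
Proof.
move=> Fp t0 FE; apply: (lorentzian_of_orthogonal gP t0) => x xt.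
apply: contra_neqT; rewrite -leNgt => gxx; apply: (proper_cone_set Fp).
  by rewrite FE; split; rewrite /causal_cone/= ?xt.
rewrite FE -scaleN1r; split; rewrite /causal_cone/= (ipZl gP) ?xt ?mulr0//.
by rewrite (ipZr gP) mulrA mulrNN !mul1r.
Qed.

End InducedInnerProduct.

(** The path [e |-> t + e *: v] is continuous and passes through [t] at 0, so
it stays in a neighborhood of [t] for small [e > 0]. *)
Lemma nbhs_radial (R : realType) (W : preTopologicalLmodType R) (A : set W)
    (t v : W) :
  vector_topology W -> nbhs t A -> exists2 e : R, 0 < e & A (t + e *: v).
Proof.
move=> [addc scalec] tA.
have c1 : (e, v) @[e --> (0 : R^o)] --> ((0 : R^o), v).
  exact: (cvg_pair (G := nbhs (0 : R^o)) (H := nbhs v) cvg_id (cvg_cst v)).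
have c2 : e *: v @[e --> (0 : R^o)] --> (0 : R^o) *: v.
  exact: (cvg_comp _ _ c1 (scalec ((0 : R^o), v))).
have c3 : (t, e *: v) @[e --> (0 : R^o)] --> (t, (0 : R^o) *: v).
  exact: (cvg_pair (G := nbhs t) (H := nbhs ((0 : R^o) *: v)) (cvg_cst t) c2).
have c4 : t + e *: v @[e --> (0 : R^o)] --> t + (0 : R^o) *: v.
  exact: (cvg_comp _ _ c3 (addc (t, (0 : R^o) *: v))).
have : nbhs (0 : R^o) [set e : R^o | A (t + e *: v)].
  by apply: c4; rewrite scale0r addr0.
move=> /nbhs_ballP[r /= r0 rA]; exists (r / 2); first by rewrite divr_gt0.
apply: rA; rewrite /ball /= sub0r normrN gtr0_norm ?divr_gt0//.
by rewrite ltr_pdivrMr// ltr_pMr// ltr1n.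
Qed.

Lemma core_of_null_boundary (R : realType) (F : linearConeType R)
    (g : cone_span F -> cone_span F -> R) (T : isOpenTopological (cone_span F))
    (t : F) :
  vector_topology (with_topology T) -> null_on_boundary g T ->
  g (embed t) (embed t) != 0 -> core F t.
Proof.
move=> Tv bdry gt v.
have tF : cone_set F (embed t) by exists t.
apply: (nbhs_radial (W := with_topology T) v Tv).
apply: contrapT => nint; move/eqP: gt; apply; apply: bdry; split=> //.
exact: (@subset_closure (with_topology T)).
Qed.

Theorem theorem3p22 (R : realType) (F : linearConeType R) (nrm : F -> \bar R)
  (Fproper : proper_cone F)
  (nrm_hyp : hyperbolic_norm nrm)
  (nrm_fin : finite_norm nrm)
  (nrm_pol : positively_polarizable nrm)
  (nrm_unit : exists t : F, nrm t = 1%:E)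
  (nrm_strict : strictly_hyperbolic nrm)
  (cond :
    [\/ exists t : cone_span F,
          0 < induced_ip nrm t t /\ cone_set F = future_cone (induced_ip nrm) t,
        exists2 t : F, core F t & nrm t = 1%:E |
        exists T : isOpenTopological (cone_span F),
          vector_topology (with_topology T) /\
          null_on_boundary (induced_ip nrm) T]) :
  lorentzian (induced_ip nrm).
Proof.
case: cond => [[t [t0 FE]] | [t tF t1] | [T [Tv bdry]]].
- exact: lorentzian_of_future_cone FE.
- exact: lorentzian_of_core t1.
- have [t t1] := nrm_unit; apply: lorentzian_of_core (t1) => //.
  apply: core_of_null_boundary Tv bdry _.
  by rewrite induced_ip_sqr // t1 expr1n oner_neq0.
Qed.
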